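(* Let $\mathscr{B}$ and $\mathscr{S}$ be subsets of $\mathbb{N}_0$ that are complete additive complements, i.e. $\mathscr{B}+\mathscr{S}=\mathbb{N}_0$, and suppose that their counting functions satisfy $$\mathscr{B}(x)\,\mathscr{S}(x)\ll x .$$ Let $$\mathcal{A}=\big\{2^b: b\in \mathscr{B}\big\}\quad\text{and}\quad \mathcal{M}=\Big\{\sum_{d\in \mathcal{D}}2^{d}:\ \mathcal{D}\subset\mathscr{S},\ 0<|\mathcal{D}|<\infty\Big\}.$$ Then $p(n,\mathcal{A},\mathcal{M})>0$ for every $n\in\mathbb{N}$, and $p=p(n,\mathcal{A},\mathcal{M})$ has polynomial growth.
   Context: $\mathbb{N}$ is the set of positive integers and $\mathbb{N}_0=\mathbb{N}\cup\{0\}$. For $\mathcal{Y}\subseteq\mathbb{N}_0$, $\mathcal{Y}(x)$ denotes the number of elements of $\mathcal{Y}$ not exceeding $x$. Subsets $\mathscr{B},\mathscr{S}\subseteq\mathbb{N}_0$ are called complete additive complements if every nonnegative integer is the sum of an element of $\mathscr{B}$ and an element of $\mathscr{S}$, i.e. $\mathscr{B}+\mathscr{S}=\{b+s: b\in\mathscr{B}, s\in\mathscr{S}\}=\mathbb{N}_0$. The notation $f(x)\ll g(x)$ means that there is a constant $C>0$ such that $f(x)\le C g(x)$ for all sufficiently large $x$. The symbol $\subset$ denotes a (not necessarily proper) subset. For $n\in\mathbb{N}$ and $\mathcal{A},\mathcal{M}\subseteq\mathbb{N}$, $p(n,\mathcal{A},\mathcal{M})$ denotes the number of representations of $n$ in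 the form $n=\sum_{a\in\mathcal{A}}m_a a$, where $m_a\in\mathcal{M}\cup\{0\}$ for all $a\in\mathcal{A}$ and only finitely many $m_a$ are nonzero (that is, the number of such families $(m_a)_{a\in\mathcal{A}}$). The function $p=p(n,\mathcal{A},\mathcal{M})$ is said to have polynomial growth if there exist a constant $c>0$ and an integer $n_0$ such that $p(n,\mathcal{A},\mathcal{M})\le n^c$ for all $n\ge n_0$. *)

(* Defs.v *)
From HB Require Import structures.
From mathcomp Require Export all_boot all_order all_algebra finmap.
From mathcomp Require Export all_classical all_reals all_analysis.

Set Implicit Arguments.
Unset Strict Implicit.
Unset Printing Implicit Defensive.

Export Order.TTheory GRing.Theory Num.Theory.
Export numFieldNormedType.Exports.

Local Open Scope classical_set_scope.
Local Open Scope ring_scope.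

Definition complete_additive_complements (B S : set nat) : Prop :=
  [set (b + s)%N | b in B & s in S] = setT.

Definition counting (R : realType) (Y : set nat) (x : R) : nat :=
  #|` fset_set [set y : nat | Y y /\ y%:R <= x]|%fset.

Lemma finite_counting (R : realType) (Y : set nat) (x : R) :
  finite_set [set y : nat | Y y /\ y%:R <= x].
Proof.
apply: (@sub_finite_set _ _ `I_(Num.truncn x).+1) => //= y [_ yx].
have x0 : 0 <= x by apply: le_trans yx.
by rewrite /mkset ltnS truncn_ge_nat.
Qed.

(* The one-sided Vinogradov relation f(x) << g(x) as x -> +oo: there is no
   absolute value around f. *)
Definition vinogradov (R : realType) (f g : R -> R) : Prop :=
  exists2 C : R, 0 < C & \forall x \near +oo, f x <= C * g x.

(* A family (m_a)_{a in A} with finitely many nonzero terms is encoded as a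
   finitely supported function on nat which vanishes outside A. *)
Definition representations (n : nat) (A M : set nat) :
    set {fsfun nat -> nat with 0%N} :=
  [set m : {fsfun nat -> nat with 0%N} |
    [/\ [set` finsupp m] `<=` A,
        forall a, A a -> (M `|` [set 0%N]) (m a) &
        (\sum_(a <- finsupp m) m a * a)%N = n]].

(* fset_set sends infinite sets to the empty one; this default value is never
   used when A consists of positive integers, by finite_representations. *)
Definition p (n : nat) (A M : set nat) : nat :=
  #|` fset_set (representations n A M)|%fset.

Lemma finite_representations (n : nat) (A M : set nat) :
  ~ A 0%N -> finite_set (representations n A M).
Proof.
move=> A0.
pose D := [fset k in iota 0 n.+1]%fset.
pose g (h : {ffun 'I_n.+1 -> 'I_n.+1}) : {fsfun nat -> nat with 0%N} :=
  [fsfun k in D => (h (inord k) : nat) | 0%N].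
apply: (@sub_finite_set _ _ (g @` setT)); last exact/finite_image.
move=> m [mA _ sm].
have bd a : a \in finsupp m -> (a <= n)%N /\ (m a <= n)%N.
  move=> ma; have a0 : (0 < a)%N.
    by rewrite lt0n; apply/eqP => a0; subst a; apply: A0; exact: mA.
  have ma0 : (0 < m a)%N by rewrite lt0n -mem_finsupp.
  have le : (m a * a <= n)%N by rewrite -sm (big_fsetD1 a) //= leq_addr.
  by split; apply: leq_trans le; [rewrite leq_pmull|rewrite leq_pmulr].
exists [ffun i : 'I_n.+1 => inord (m i)] => //.
have memD k : (k \in D) = (k <= n)%N by rewrite !inE mem_iota; case: k.
apply/fsfunP => k; rewrite /g fsfunE memD.
have [km|km] := boolP (k \in finsupp m).
  have [kn mkn] := bd _ km.
  by rewrite kn ffunE !inordK.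
by case: leqP => kn; rewrite ?ffunE ?(@inordK n k) // (fsfun_dflt km) ?inordK.
Qed.

(* c is a real exponent; a `^ c is the real power. *)
Definition polynomial_growth (R : realType) (f : nat -> nat) : Prop :=
  exists2 c : R, 0 < c &
    exists n0 : nat, forall n : nat, (0 < n)%N -> (n0 <= n)%N ->
      (f n)%:R <= n%:R `^ c.

Definition powers_of_two (B : set nat) : set nat :=
  [set (2 ^ b)%N | b in B].

Definition finite_binary_sums (S : set nat) : set nat :=
  [set (\sum_(d <- D) 2 ^ d)%N | D in
    [set D : {fset nat} | [set` D] `<=` S /\ (0 < #|` D|)%N]].

(* Main.v *)
Require Import Defs.

Local Open Scope classical_set_scope.
Local Open Scope ring_scope.

(** Choosing binary digits for every multiplicity turns a representation of n
    into a finite set P of pairs (b, s) in B x S such that n is the sum of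
    2 ^ (b + s) over P: the multiplicity of 2 ^ b is the sum of 2 ^ s over the
    fibre of P above b.  The map [multiplicities] goes back from P to the
    representation, and both halves of the theorem come from it.

    Existence ([sum_multiplicities], [representations_gt0]): write n in binary
    and split every exponent e as b + s with b in B and s in S.  Distinct
    exponents give distinct pairs, so n is the sum of 2 ^ (b + s) over the set
    of these pairs.

    Growth ([representations_le_exp]): a pair (b, s) used for n satisfies
    2 ^ (b + s) <= n, so b and s are at most L, the integer part of the base 2
    logarithm of n.  There are at most B(L) S(L) such pairs, hence at most C L
    when n is large.  Every representation is the image of a set of them, so
    there are at most 2 ^ (C L) <= n ^ C representations. *)

Definition multiplicities (P : {fset nat * nat}) : {fsfun nat -> nat with 0%N} :=
  [fsfun a in [fset (2 ^ x.1)%N | x in P]%fset =>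
     (\sum_(x <- P | (2 ^ x.1)%N == a) 2 ^ x.2)%N | 0%N].

Lemma multiplicitiesE (P : {fset nat * nat}) (a : nat) :
  multiplicities P a = (\sum_(x <- P | (2 ^ x.1)%N == a) 2 ^ x.2)%N.
Proof.
rewrite /multiplicities fsfunE; case: ifPn => // aP.
rewrite big_seq_cond big1// => x /andP[xP /eqP xa].
by case/negP: aP; apply/imfsetP; exists x.
Qed.

Lemma finsupp_multiplicities (P : {fset nat * nat}) (a : nat) :
  (a \in finsupp (multiplicities P)) = (a \in [fset (2 ^ x.1)%N | x in P]%fset).
Proof.
rewrite mem_finsupp multiplicitiesE; apply/idP/imfsetP => /= [|[x xP ->]].
  apply: contra_neqP => nex; rewrite big_seq_cond big1// => x /andP[xP /eqP xa].
  by case: nex; exists x.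
by rewrite -lt0n (big_rem x)//= eqxx addn_gt0 expn_gt0.
Qed.

(** The double sum over a and over the pairs (b, s) with 2 ^ b = a is
    exchanged: each pair meets exactly one a. *)
Lemma sum_multiplicities (P : {fset nat * nat}) :
  (\sum_(a <- finsupp (multiplicities P)) multiplicities P a * a =
   \sum_(x <- P) 2 ^ (x.1 + x.2))%N.
Proof.
under eq_bigr do rewrite multiplicitiesE big_distrl/=.
rewrite (exchange_big_dep xpredT)//=.
rewrite big_seq [RHS]big_seq; apply: eq_bigr => x xP.
under eq_bigl do rewrite eq_sym.
have xM : (2 ^ x.1)%N \in finsupp (multiplicities P).
  by rewrite finsupp_multiplicities; apply/imfsetP; exists x.
rewrite -big_filter (filter_pred1_uniq (fset_uniq _) xM) big_seq1.
by rewrite expnD mulnC.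
Qed.

(** As 2 ^ b determines b, the pairs counted at 2 ^ b form the fibre of P above
    b, on which the second projection is injective: the exponents in D are
    distinct binary digits. *)
Lemma multiplicities_fibre (P : {fset nat * nat}) (b : nat) (D : {fset nat}) :
  (forall d, (d \in D) = ((b, d) \in P)) ->
  multiplicities P (2 ^ b)%N = (\sum_(d <- D) 2 ^ d)%N.
Proof.
move=> DP; rewrite multiplicitiesE.
under eq_bigl do rewrite eqn_exp2l//.
rewrite -big_filter -(big_map snd xpredT (expn 2)).
apply/perm_big/uniq_perm; rewrite ?fset_uniq//.
  rewrite map_inj_in_uniq ?filter_uniq ?fset_uniq// => -[x1 x2] [y1 y2].
  by rewrite !mem_filter /= => /andP[/eqP-> _] /andP[/eqP-> _] ->.
move=> d; rewrite DP; apply/mapP/idP => [[[b' d']]|bd].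
  by rewrite mem_filter /= => /andP[/eqP -> bd] ->.
by exists (b, d) => //; rewrite mem_filter eqxx.
Qed.

(** An empty fibre is what gives the multiplicity 0, excluded from
    [finite_binary_sums]. *)
Lemma multiplicities_digits (S : set nat) (P : {fset nat * nat}) (b : nat) :
  (forall x, x \in P -> S x.2) ->
  (finite_binary_sums S `|` [set 0%N]) (multiplicities P (2 ^ b)%N).
Proof.
move=> PS; pose D := [fset x.2 | x in P & x.1 == b]%fset.
have DP d : (d \in D) = ((b, d) \in P).
  apply/imfsetP/idP => [[[b' d']]|bd] /=.
    by rewrite !inE /= => /andP[bd /eqP <-] ->.
  by exists (b, d) => //; rewrite !inE bd /=.
rewrite (multiplicities_fibre _ _ _ DP).
have [D0|D0] := posnP #|` D|%fset.
  by right; rewrite (cardfs0_eq D0) big_seq_fset0.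
left; exists D => //; split => // d /imfsetP[x /=].
by rewrite !inE => /andP[xP _] ->; exact: PS.
Qed.

Lemma multiplicities_representation (B S : set nat) (P : {fset nat * nat}) :
  (forall x, x \in P -> B x.1 /\ S x.2) ->
  representations (\sum_(x <- P) 2 ^ (x.1 + x.2))%N
    (powers_of_two B) (finite_binary_sums S) (multiplicities P).
Proof.
move=> PBS; split; last exact: sum_multiplicities.
- move=> a /=; rewrite finsupp_multiplicities => /imfsetP[x /= xP ->].
  by exists x.1 => //; have [] := PBS _ xP.
- by move=> _ [b _ <-]; apply: multiplicities_digits => x /PBS[].
Qed.

(** The bound on the exponents ensures, in the induction on k, that the top
    digit k is new. *)
Lemma binary_expansion (k n : nat) : (n < 2 ^ k)%N ->
  exists2 E : {fset nat}, (forall e, e \in E -> (e < k)%N) &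
    n = (\sum_(e <- E) 2 ^ e)%N.
Proof.
elim: k n => [|k IH] n.
  rewrite expn0 ltnS leqn0 => /eqP ->.
  by exists fset0 => [e|]; rewrite ?inE// big_seq_fset0.
have [/IH[E Ek ->] _|kn] := ltnP n (2 ^ k).
  by exists E => // e /Ek /ltnW.
rewrite expnS mul2n -addnn -ltn_subLR// => /IH[E Ek nE].
exists (k |` E)%fset => [e|].
  by rewrite !inE => /orP[/eqP ->//|/Ek /ltnW].
rewrite big_fsetU1/= -?nE ?subnKC//.
by apply/negP => /Ek; rewrite ltnn.
Qed.

Lemma powers_of_two_neq0 (B : set nat) : ~ powers_of_two B 0%N.
Proof. by move=> [b _ /eqP]; rewrite expn_eq0. Qed.

Lemma representations_gt0 (B S : set nat) (n : nat) :
  complete_additive_complements B S ->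
  (0 < p n (powers_of_two B) (finite_binary_sums S))%N.
Proof.
move=> hBS.
have /choice[c cP] : forall e, exists x : nat * nat,
    [/\ B x.1, S x.2 & (x.1 + x.2)%N = e].
  move=> e; have : [set: nat] e by [].
  by rewrite -hBS => -[b Bb [s Ss <-]]; exists (b, s).
have [E _ nE] := binary_expansion _ _ (ltn_expl n (ltnSn 1)).
pose P := [fset c e | e in E]%fset.
have cI : injective c.
  by move=> e f ef; have [_ _ <-] := cP e; rewrite ef; have [] := cP f.
have nP : n = (\sum_(x <- P) 2 ^ (x.1 + x.2))%N.
  rewrite nE big_imfset/=; last by move=> ? ? _ _; exact: cI.
  by apply: eq_bigr => e _; have [_ _ ->] := cP e.
rewrite cardfs_gt0; apply/fset0Pn; exists (multiplicities P).
rewrite in_fset_set; last exact/finite_representations/powers_of_two_neq0.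
rewrite inE {1}nP; apply: multiplicities_representation => x /imfsetP[e _ ->].
by have [] := cP e.
Qed.

(** Every representation is [multiplicities] of some subset P of Q, so the
    subsets of Q are at least as many as the representations.  To find P for a
    representation m, pick a digit set D a of every multiplicity m a and keep
    the pairs (b, s) with s in D (2 ^ b).  Such a pair contributes
    2 ^ s * 2 ^ b to n, which puts it in Q. *)
Lemma representations_le_exp (B S : set nat) (n : nat) (Q : {fset nat * nat}) :
  (forall b s, B b -> S s -> (2 ^ (b + s) <= n)%N -> (b, s) \in Q) ->
  (p n (powers_of_two B) (finite_binary_sums S) <= 2 ^ #|` Q|)%N.
Proof.
move=> QP; rewrite -card_fpowerset.
apply: (@leq_trans #|` [fset multiplicities P | P in fpowerset Q]|)%fset;
  last exact: leq_imfset_card.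
apply/fsubset_leq_card/fsubsetP => m.
rewrite in_fset_set; last exact/finite_representations/powers_of_two_neq0.
rewrite inE => -[mA mM mn].
have /choice[D DP] : forall a, exists D : {fset nat},
    (forall d, d \in D -> S d) /\ m a = (\sum_(d <- D) 2 ^ d)%N.
  move=> a; have [/mA/mM[[D [DS _] <-]|/= ->]|am] := boolP (a \in finsupp m).
  - by exists D; split.
  - by exists fset0; rewrite big_seq_fset0.
  - by exists fset0; rewrite (fsfun_dflt am) big_seq_fset0.
have DQ b s : s \in D (2 ^ b)%N -> (b, s) \in Q.
  move=> sD; have [DS mE] := DP (2 ^ b)%N.
  have sm : (2 ^ s <= m (2 ^ b))%N by rewrite mE (big_fsetD1 s)//= leq_addr.
  have bm : (2 ^ b)%N \in finsupp m.
    by rewrite mem_finsupp -lt0n (leq_trans _ sm)// expn_gt0.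
  apply: QP; [|exact: DS|].
    by have [b' Bb' /eqP] := mA _ bm; rewrite eqn_exp2l// => /eqP <-.
  rewrite -mn (big_fsetD1 (2 ^ b)%N)//= expnD mulnC.
  by apply: leq_trans (leq_addr _ _); rewrite leq_mul2r sm orbT.
pose P := [fset x in Q | x.2 \in D (2 ^ x.1)%N]%fset.
apply/imfsetP; exists P => /=.
  by rewrite fpowersetE; apply/fsubsetP => x; rewrite !inE => /andP[].
apply/fsfunP => a; have [am|am] := boolP (a \in finsupp m); last first.
  rewrite (fsfun_dflt am) multiplicitiesE big_seq_cond big1// => x.
  rewrite !inE => /andP[/andP[_ xD] /eqP xa]; move: am xD.
  rewrite xa mem_finsupp; have [_ ->] := DP a => /negPn/eqP D0 xD.
  by move: D0; rewrite (big_rem x.2)//= => /eqP; rewrite addn_eq0 expn_eq0.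
have [b _ ba] := mA _ am; subst a; have [_ ->] := DP (2 ^ b)%N.
apply/esym/multiplicities_fibre => d.
by rewrite !inE /=; apply/idP/andP => [dD|[]//]; split=> //; exact: DQ.
Qed.

Lemma mem_counting (R : realType) (Y : set nat) (k L : nat) :
  Y k -> (k <= L)%N -> k \in fset_set [set y : nat | Y y /\ y%:R <= L%:R :> R].
Proof.
move=> Yk kL; rewrite in_fset_set; last exact: finite_counting.
by rewrite inE; split; rewrite ?ler_nat.
Qed.

Lemma card_fsetM (K K' : choiceType) (X : {fset K}) (Y : {fset K'}) :
  #|` (X `*` Y)%fset|%fset = (#|` X|%fset * #|` Y|%fset)%N.
Proof.
rewrite -(size_allpairs pair); apply/perm_size/uniq_perm; rewrite ?fset_uniq//.
  by rewrite allpairs_uniq ?fset_uniq// => -[? ?] [? ?] _ _ [-> ->].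
move=> [x y]; rewrite in_fsetM; apply/andP/allpairsP => [[xX yY]|[[x' y']]].
  by exists (x, y).
by move=> [? ?] [-> ->].
Qed.

Lemma representations_le_counting (R : realType) (B S : set nat) (n : nat) :
  (p n (powers_of_two B) (finite_binary_sums S) <=
   2 ^ (counting B ((trunc_log 2 n)%:R : R) *
        counting S ((trunc_log 2 n)%:R : R)))%N.
Proof.
rewrite -card_fsetM; apply: representations_le_exp => b s Bb Ss bsn.
have bsL : (b + s <= trunc_log 2 n)%N by apply: trunc_log_max.
by rewrite in_fsetM/= !mem_counting ?(leq_trans _ bsL) ?leq_addr ?leq_addl.
Qed.

Theorem theorem1 (R : realType) (B S : set nat)
    (hBS : complete_additive_complements B S)
    (hcount : vinogradov (fun x : R => (counting B x)%:R * (counting S x)%:R)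
                         (fun x : R => x)) :
  (forall n : nat, (0 < n)%N ->
     (0 < p n (powers_of_two B) (finite_binary_sums S))%N) /\
  polynomial_growth R (fun n => p n (powers_of_two B) (finite_binary_sums S)).
Proof.
split=> [n _|]; first exact: representations_gt0.
have [C C0 [M [_ MC]]] := hcount.
(* From 2 ^ (truncn M + 1) on, the base 2 logarithm of n exceeds the
   threshold M beyond which the hypothesis on B and S applies. *)
exists C => //; exists (2 ^ (Num.truncn M).+1)%N => n n0 Mn.
pose L := trunc_log 2 n.
have ML : M < L%:R.
  apply: lt_le_trans (truncnS_gt _) _.
  by rewrite ler_nat; apply: trunc_log_max.
have Ln : (2 ^ L <= n)%N by apply: trunc_logP.
apply: (@le_trans _ _ (2 `^ (C * L%:R))).
  apply: (@le_trans _ _ (2 ^ (counting B (L%:R : R) * counting S (L%:R : R)))%N%:R).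
    by rewrite ler_nat; exact: representations_le_counting.
  rewrite natrX -powR_mulrn// natrM.
  by apply: ler_powR; [rewrite ler1n|exact: MC].
rewrite mulrC powRrM powR_mulrn// -natrX.
by apply: ge0_ler_powR; rewrite ?nnegrE ?ler_nat// ltW.
Qed.
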